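(* Let $q$ be a prime power and let $f_1, f_2 \in \mathbb{F}_q[x]$ be two distinct (i.e. non-associate) irreducible polynomials of the same degree. Let $n \geq 2$ be a positive integer, $f = f_1^n f_2$, $$D_1 = \{1, f_2, f_1^2, \ldots, f_1^n\} = \{1, f_2\} \cup \{f_1^j : 2 \leq j \leq n\},$$ and $$D_2 = \{1, f_2, f_1 f_2\}.$$ Then $G_f(D_1)$ and $G_f(D_2)$ are isomorphic.
   Context: For a nonconstant $f \in \mathbb{F}_q[x]$, $\mathrm{Div}(f)$ is the set of divisors of $f$ up to multiplication by nonzero constants; for $D \subset \mathrm{Div}(f)$ with $f \notin D$, the gcd-graph $G_f(D)$ is the simple undirected graph with vertex set $\mathbb{F}_q[x]/f$ in which $a,b$ are adjacent iff $\gcd(a-b,f) \in D$ (gcd taken up to nonzero constants). *)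

(* Defs.v *)
From mathcomp Require Import all_boot all_order all_algebra all_field.

Set Implicit Arguments.
Unset Strict Implicit.
Unset Printing Implicit Defensive.

Import GRing.Theory Pdiv.Ring.
Local Open Scope ring_scope.

Definition graph_isomorphic (V1 V2 : finType) (e1 : rel V1) (e2 : rel V2) : Prop :=
  exists phi : V1 -> V2, bijective phi /\ forall x y, e2 (phi x) (phi y) = e1 x y.

Section GcdGraph.
Variable F : finFieldType.
Implicit Types (f g p q : {poly F}) (D : seq {poly F}).

(* A set of polynomials up to nonzero constant factors is represented by a
   list of representatives. *)
Definition mem_assoc g D : bool := has (eqp g) D.

(* {poly %/ h} is the quotient by h only for h monic of positive degree (else
   it is the quotient by 'X), so F[x]/(f) is taken modulo the monic associate
   of f; see in_poly_quot_eq. *)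
Definition monic_assoc f : {poly F} := (lead_coef f)^-1 *: f.
Definition poly_quot f : finType := {poly %/ monic_assoc f}.

(* The edge relation of G_f(D) for f nonconstant; the gcd with f does not
   depend on the representative of the class a - b, see gcd_adj_class.  As in
   the usual definition, D is meant to consist of proper divisors of f. *)
Definition gcd_adj f D : rel (poly_quot f) :=
  fun a b : {poly %/ monic_assoc f} =>
    mem_assoc (gcdp (a - b : {poly %/ monic_assoc f}) f) D.

Definition divs1 (f1 f2 : {poly F}) (n : nat) : seq {poly F} :=
  [:: 1, f2 & [seq f1 ^+ j | j <- index_iota 2 n.+1]].

Definition divs2 (f1 f2 : {poly F}) : seq {poly F} := [:: 1; f2; f1 * f2].

Lemma mk_monic_assoc f : (1 < size f)%N -> mk_monic (monic_assoc f) = monic_assoc f.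
Proof.
move=> sf; have nz : lead_coef f != 0.
  by rewrite lead_coef_eq0 -size_poly_gt0 ltnW.
rewrite /mk_monic /monic_assoc size_scale ?invr_eq0 // sf /=.
by rewrite monicE lead_coefZ mulVf // eqxx.
Qed.

Lemma monic_assoc_eqp f : (1 < size f)%N -> monic_assoc f %= f.
Proof.
move=> sf; apply: eqp_scale; rewrite invr_eq0 lead_coef_eq0.
by rewrite -size_poly_gt0 ltnW.
Qed.

Lemma in_qpolyE f p : (1 < size f)%N ->
  in_qpoly (monic_assoc f) p = p %% monic_assoc f :> {poly F}.
Proof.
move=> sf; rewrite /in_qpoly /= mk_monic_assoc // Pdiv.IdomainMonic.modpE //.
by rewrite -(mk_monic_assoc sf) monic_mk_monic.
Qed.

Lemma in_poly_quot_eq f p q : (1 < size f)%N ->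
  (in_qpoly (monic_assoc f) p == in_qpoly (monic_assoc f) q) = (f %| p - q).
Proof.
move=> sf; rewrite -subr_eq0 -linearB -(inj_eq val_inj) [val _]in_qpolyE //.
exact: (eqp_dvdl _ (monic_assoc_eqp sf)).
Qed.

Lemma mem_assoc_eqp g p D : g %= p -> mem_assoc g D = mem_assoc p D.
Proof. by move=> gp; apply: eq_has => d /=; apply: eqp_ltrans. Qed.

Lemma gcd_adj_class f D p q : (1 < size f)%N ->
  gcd_adj D (in_qpoly (monic_assoc f) p) (in_qpoly (monic_assoc f) q)
    = mem_assoc (gcdp (p - q) f) D.
Proof.
move=> sf; apply: mem_assoc_eqp; rewrite -linearB in_qpolyE //.
have fE := monic_assoc_eqp sf; set m := monic_assoc f in fE *.
apply: (eqp_trans (y := gcdp ((p - q) %% m) m)).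
  by apply: eqp_gcdr; rewrite eqp_sym.
by apply: eqp_trans (eqp_gcdr _ fE); apply: gcdp_modl.
Qed.

Lemma gcd_adj_sym f D : symmetric (@gcd_adj f D).
Proof.
move=> a b; apply: mem_assoc_eqp; apply: eqp_gcdl.
rewrite -[in X in _ %= X](opprB (a : {poly %/ monic_assoc f})) /=.
by rewrite eqp_sym -scaleN1r; apply: eqp_scale; rewrite oppr_eq0 oner_eq0.
Qed.

Lemma gcd_adj_irr f D : ~~ mem_assoc f D -> irreflexive (@gcd_adj f D).
Proof. by move=> fD a; rewrite /gcd_adj subrr gcd0p (negbTE fD). Qed.

Section Divisors.
Variables (f1 f2 : {poly F}) (n : nat).
Hypotheses (irr1 : irreducible_poly f1) (irr2 : irreducible_poly f2).
Hypothesis n_ge2 : (2 <= n)%N.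
Let f := f1 ^+ n * f2.

Lemma size_f_gt1 : (1 < size f)%N.
Proof.
have f10 := irredp_neq0 irr1; have f20 := irredp_neq0 irr2.
apply: leq_trans irr2.1 _; apply: dvdp_leq; last exact: dvdp_mull.
by rewrite mulf_neq0 // expf_neq0.
Qed.

Lemma divs1_dvd : all (fun d => d %| f) (divs1 f1 f2 n).
Proof.
rewrite /= dvd1p dvdp_mull //=; apply/allP => _ /mapP[j + ->].
by rewrite mem_index_iota ltnS => /andP[_ jn]; rewrite dvdp_mulr // dvdp_exp2l.
Qed.

Lemma divs2_dvd : all (fun d => d %| f) (divs2 f1 f2).
Proof.
rewrite /= dvd1p dvdp_mull //= andbT dvdp_mul // -{1}[f1]expr1 dvdp_exp2l //.
exact: ltnW.
Qed.

Let nzf1 : f1 != 0. Proof. exact: irredp_neq0. Qed.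
Let nzf2 : f2 != 0. Proof. exact: irredp_neq0. Qed.

Let size_f g : g != 0 -> (size g < size (f1 * g)%R)%N.
Proof.
move=> g0; rewrite size_mul //; have := irr1.1.
by case: (size f1) => [|[|k]] // _; rewrite !addSn /= ltnS leq_addl.
Qed.

Let neqp_f (d : {poly F}) : (size d < size f)%N -> ~~ (f %= d).
Proof. by move=> sd; apply/negP => /eqp_size e; rewrite e ltnn in sd. Qed.

Let fE : f = f1 * (f1 ^+ n.-1 * f2).
Proof. by rewrite /f mulrA -exprS prednK // ltnW. Qed.

Lemma f_notin_divs2 : ~~ mem_assoc f (divs2 f1 f2).
Proof.
have s2 : (size (f1 * f2)%R < size f)%N.
  rewrite fE (leq_ltn_trans _ (size_f _)) ?mulf_neq0 ?expf_neq0 //.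
  apply: dvdp_leq; first by rewrite mulf_neq0 ?expf_neq0.
  by apply: dvdp_mul => //; apply: dvdp_exp; case: (n) n_ge2 => [|[|]].
rewrite /mem_assoc /= !negb_or !neqp_f ?size_poly1 ?size_f_gt1 //.
by apply: ltn_trans s2; apply: size_f.
Qed.

Lemma f_notin_divs1 : ~~ mem_assoc f (divs1 f1 f2 n).
Proof.
have := f_notin_divs2; rewrite /mem_assoc /= !negb_or => /and4P[-> -> _ _] /=.
apply/hasPn => _ /mapP[j + ->]; rewrite mem_index_iota ltnS => /andP[_ jn].
apply: neqp_f; apply: (@leq_ltn_trans (size (f1 ^+ n))).
  by apply: dvdp_leq; rewrite ?expf_neq0 // dvdp_exp2l.
rewrite size_mul ?expf_neq0 //; have := irr2.1.
by case: (size f2) => [|[|k]] // _; rewrite !addnS /= ltnS leq_addr.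
Qed.

End Divisors.
End GcdGraph.

(* Main.v *)
(** For [f = f1 ^ n * f2] and a difference [c] of two vertices, [c] is an edge
    of [G_f(D1)] iff [f1] does not divide [c], or [f1 ^ 2] divides [c] and [f2]
    does not; it is an edge of [G_f(D2)] iff [f1] does not divide [c], or [f2]
    divides [c] and [f1 ^ 2] does not.  So for two vertices congruent mod [f1],
    adjacency depends only on whether their digits at [f1 ^ 1] agree and whether
    their residues mod [f2] agree, with these two roles exchanged between the
    graphs.  Since [f1] and [f2] have the same degree, both data range over the
    polynomials of degree less than [deg f1]; exchanging them (and keeping the
    other [f1]-adic digits) is an isomorphism. *)
Require Import Defs.
From mathcomp Require Import all_boot all_order all_algebra all_field.
From mathcomp Require Import ring.
Import GRing.Theory.
Local Open Scope ring_scope.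

Section Polynomials.
Variable F : fieldType.
Implicit Types (d p q : {poly F}).

Lemma dvdp_subE d p q : (d %| p - q) = (p %% d == q %% d).
Proof. by rewrite -subr_eq0 -modpN -modpD; apply: (sameP (modp_eq0P _ _) eqP). Qed.

Lemma irredp_dvd_irredp d p :
  irreducible_poly d -> irreducible_poly p -> (d %| p) = (d %= p).
Proof.
move=> irrd irrp; apply/idP/idP => [dp|/eqp_dvdl-> //].
by apply: irrp.2 dp; rewrite gtn_eqF // irrd.1.
Qed.

Lemma irredp_coprimep d p : irreducible_poly d -> irreducible_poly p ->
  ~~ (d %= p) -> coprimep d p.
Proof. by move=> irrd irrp; rewrite irreducible_poly_coprime // irredp_dvd_irredp. Qed.

(** Induction on [n]: a factor [d] of [p] cancels on both sides; if [d] does not divide [p],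
    coprimality removes one [d] from the power. *)
Lemma dvdp_irred_exp d p n : irreducible_poly d -> p %| d ^+ n ->
  exists2 j, (j <= n)%N & p %= d ^+ j.
Proof.
move=> irrd; elim: n p => [|n IHn] p; first by
  rewrite expr0 dvdp1 size_poly_eq1; exists 0.
have [dp|dNp] := boolP (d %| p); last first.
  rewrite exprS Gauss_dvdpr; first by move=> /IHn[j jn pj]; exists j; first exact: leqW.
  by rewrite coprimep_sym irreducible_poly_coprime.
have d0 := irredp_neq0 irrd; rewrite -(divpK dp) mulrC exprS dvdp_mul2l //.
by move=> /IHn[j jn pj]; exists j.+1; rewrite // exprS eqp_mul2l.
Qed.

(** The coefficient of [d ^ 1] in the [d]-adic expansion of [p]. *)
Definition digit1 d p := (p %/ d) %% d.

Lemma dvdp_sqr_subE d p q : d != 0 ->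
  (d ^+ 2 %| p - q) = (p %% d == q %% d) && (digit1 d p == digit1 d q).
Proof.
move=> d0; have [epq|npq] := eqVneq; last first.
  apply: contraNF npq => d2; rewrite -dvdp_subE; apply: dvdp_trans d2.
  exact: dvdp_mulr.
rewrite -dvdp_subE expr2 -(dvdp_mul2l d (_ - _) d0); congr (_ %| _).
by rewrite {1}(divp_eq p d) {1}(divp_eq q d) epq; ring.
Qed.

Lemma modpD_mul d p q : (p + d * q) %% d = p %% d.
Proof. by rewrite modpD modp_mulr addr0. Qed.

Lemma digit1D_mul d p q : d != 0 ->
  digit1 d (p + d * q) = digit1 d p + q %% d.
Proof.
by move=> d0; rewrite /digit1 -modpD addrC mulrC divp_addl_mul // addrC.
Qed.

(** The last two clauses let [phi] descend to an involution modulo [f1 ^ n * f2]. *)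
Lemma exists_digit_swap (f1 f2 : {poly F}) (n : nat) : (2 <= n)%N ->
    coprimep (f1 ^+ n) f2 -> f1 != 0 -> f2 != 0 -> size f1 = size f2 ->
  exists phi : {poly F} -> {poly F},
    [/\ forall p, [/\ phi p %% f1 = p %% f1, digit1 f1 (phi p) = p %% f2
                    & phi p %% f2 = digit1 f1 p],
        forall p, f1 ^+ n * f2 %| phi (phi p) - p
      & forall p q, f1 ^+ n * f2 %| p - q -> f1 ^+ n * f2 %| phi p - phi q].
Proof.
move=> n2 cop f10 f20 ss.
have [[u v] /= uv] := Bezout_eq1_coprimepP _ _ cop.
(* [psi] replaces the digit at [f1 ^ 1] by the residue mod [f2]. Since [u * f1 ^ n] is 0 mod
   [f1 ^ n] and 1 mod [f2], [phi p] is congruent to [psi p] mod [f1 ^ n] and to the old digit mod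
   [f2]. *)
pose psi p := p + f1 * (p %% f2 - digit1 f1 p).
pose phi p := psi p + u * f1 ^+ n * (digit1 f1 p - psi p).
have phi1 p : f1 ^+ n %| phi p - psi p.
  by rewrite /phi addrC addKr mulrAC dvdp_mull.
have phi2 p : f2 %| phi p - digit1 f1 p.
  suff -> : phi p - digit1 f1 p = (psi p - digit1 f1 p) * v * f2 by apply: dvdp_mull.
  rewrite -mulrA; have -> : v * f2 = 1 - u * f1 ^+ n by rewrite -uv; ring.
  by rewrite /phi; ring.
have phiE p : [/\ phi p %% f1 = p %% f1, digit1 f1 (phi p) = p %% f2
                & phi p %% f2 = digit1 f1 p].
  have := dvdp_trans (dvdp_exp2l f1 n2) (phi1 p).
  rewrite dvdp_sqr_subE // => /andP[/eqP-> /eqP->].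
  have := phi2 p; rewrite dvdp_subE => /eqP->.
  rewrite modpD_mul digit1D_mul // modpD modpN.
  (* Equal degrees enter here: a residue modulo one of [f1], [f2] is already reduced modulo the
     other. *)
  have small1 : digit1 f1 p %% f2 = digit1 f1 p.
    by rewrite modp_small // -ss ltn_modp.
  have -> : digit1 f1 p %% f1 = digit1 f1 p by rewrite modp_small // ltn_modp.
  have -> : p %% f2 %% f1 = p %% f2 by rewrite modp_small // ss ltn_modp.
  by rewrite small1 addrC subrK.
exists phi; split=> // [p|p q].
  have [e1 e2 e3] := phiE p; have [_ _ e6] := phiE (phi p).
  rewrite Gauss_dvdp // [X in _ && X]dvdp_subE e6 e2 eqxx andbT.
  (* The second swap undoes the shift of the first, so [psi (phi p) - p = phi p - psi p]. *)
  have -> : phi (phi p) - p = (phi (phi p) - psi (phi p)) + (phi p - psi p).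
    by rewrite /psi e2 e3; ring.
  exact: dvdp_add.
rewrite !Gauss_dvdp // => /andP[d1 d2].
have := dvdp_trans (dvdp_exp2l f1 n2) d1.
rewrite dvdp_sqr_subE // => /andP[_ /eqP ed].
have em : p %% f2 = q %% f2 by apply/eqP; rewrite -dvdp_subE.
have [_ _ p2] := phiE p; have [_ _ q2] := phiE q.
rewrite [X in _ && X]dvdp_subE p2 q2 ed eqxx andbT.
have -> : phi p - phi q = (phi p - psi p) + (p - q) - (phi q - psi q).
  by rewrite /psi ed em; ring.
by apply: dvdp_sub => //; apply: dvdp_add.
Qed.

End Polynomials.

Section Gcds.
Variables (F : finFieldType) (f1 f2 : {poly F}) (n : nat).
Hypotheses (irr1 : irreducible_poly f1) (irr2 : irreducible_poly f2).
Hypotheses (f1Nf2 : ~~ (f1 %= f2)) (n_ge2 : (2 <= n)%N).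
Implicit Type g : {poly F}.

Let nz1 : f1 != 0. Proof. exact: irredp_neq0. Qed.
Let nz2 : f2 != 0. Proof. exact: irredp_neq0. Qed.
Let cop12 : coprimep f1 f2. Proof. exact: irredp_coprimep. Qed.
Let f1Ndvd : ~~ (f1 %| f2). Proof. by rewrite irredp_dvd_irredp. Qed.

(** If [f1] does not divide [g], the gcd is that of [g] with the irreducible [f2]; otherwise [f1]
    divides the gcd, but neither 1 nor [f2]. *)
Lemma gcdp_1_or_f2 g :
  (gcdp g (f1 ^+ n * f2) %= 1) || (gcdp g (f1 ^+ n * f2) %= f2) = ~~ (f1 %| g).
Proof.
have [f1g|f1Ng] := boolP (f1 %| g).
  have f1gcd : f1 %| gcdp g (f1 ^+ n * f2).
    by rewrite dvdp_gcd f1g dvdp_mulr // dvdp_exp // ltnW.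
  apply/norP; split; apply/negP => /eqp_dvdr gE; move: f1gcd; rewrite gE.
    by rewrite dvdp1 gtn_eqF // irr1.1.
  by rewrite (negPf f1Ndvd).
have copg : coprimep g (f1 ^+ n).
  by rewrite coprimep_expr // coprimep_sym irreducible_poly_coprime.
have gE := Gauss_gcdpr f2 copg; rewrite !(eqp_ltrans gE).
by have [->|->] := irredp_XsubCP irr2 (dvdp_gcdr g f2); rewrite ?orbT.
Qed.

Lemma mem_gcdp_divs2 g :
  mem_assoc (gcdp g (f1 ^+ n * f2)) (divs2 f1 f2) =
    (f1 %| g) ==> (f2 %| g) && ~~ (f1 ^+ 2 %| g).
Proof.
rewrite /mem_assoc /= orbF orbA gcdp_1_or_f2 implybE.
have [f1g|//] := boolP (f1 %| g); rewrite /=.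
have f1n : f1 ^+ n = f1 * f1 ^+ n.-1 by rewrite -exprS prednK // ltnW.
apply/idP/andP => [gE|[f2g f12g]].
  split.
    apply: dvdp_trans (dvdp_gcdl g (f1 ^+ n * f2)).
    by rewrite (eqp_dvdr _ gE) dvdp_mull.
  apply/negP => f12g.
  have : f1 ^+ 2 %| gcdp g (f1 ^+ n * f2).
    by rewrite dvdp_gcd f12g dvdp_mulr // dvdp_exp2l.
  by rewrite (eqp_dvdr _ gE) dvdp_mul2l // (negPf f1Ndvd).
(* The gcd is [f1 * f2] times that of [h] and [f1 ^ n.-1], which is trivial because [f1] does not
   divide [h]. *)
have [h gE] : exists h, g = f1 * f2 * h.
  have : f1 * f2 %| g by rewrite Gauss_dvdp // f1g.
  by move=> /divpK <-; exists (g %/ (f1 * f2)); rewrite mulrC.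
have f1Nh : ~~ (f1 %| h).
  apply: contra f12g => f1h; rewrite gE mulrAC dvdp_mulr //.
  by rewrite expr2 dvdp_mul2l.
rewrite gE f1n [f1 * _ * f2]mulrAC; apply: eqp_trans (gcdp_mul2l _ _ _) _.
rewrite -[X in _ %= X]mulr1 eqp_mul2l ?mulf_neq0 //.
by rewrite -size_poly_eq1 -/(coprimep _ _) coprimep_expr // coprimep_sym
           irreducible_poly_coprime.
Qed.

Lemma mem_gcdp_divs1 g :
  mem_assoc (gcdp g (f1 ^+ n * f2)) (divs1 f1 f2 n) =
    (f1 %| g) ==> (f1 ^+ 2 %| g) && ~~ (f2 %| g).
Proof.
rewrite /mem_assoc /= orbA gcdp_1_or_f2 implybE.
have [f1g|//] := boolP (f1 %| g); rewrite /=.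
apply/hasP/andP => [[d /mapP[j]]|[f12g f2g]].
  rewrite mem_index_iota => /andP[j2 _] -> {d} gE; split.
    apply: dvdp_trans (dvdp_gcdl g (f1 ^+ n * f2)).
    by rewrite (eqp_dvdr _ gE) dvdp_exp2l.
  apply/negP => f2g.
  have : f2 %| gcdp g (f1 ^+ n * f2) by rewrite dvdp_gcd f2g dvdp_mull.
  rewrite (eqp_dvdr _ gE); apply/negP.
  rewrite -irreducible_poly_coprime // coprimep_expr //.
  by rewrite coprimep_sym.
(* As [f2] does not divide [g], the gcd is a power of [f1], and [f1 ^ 2] dividing [g] forces its
   exponent to be at least 2. *)
have gE : gcdp g (f1 ^+ n * f2) %= gcdp g (f1 ^+ n).
  by rewrite Gauss_gcdpl // coprimep_sym irreducible_poly_coprime.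
have [j jn gj] := dvdp_irred_exp _ _ _ _ irr1 (dvdp_gcdr g (f1 ^+ n)).
exists (f1 ^+ j); last exact: eqp_trans gE gj.
apply/mapP; exists j => //; rewrite mem_index_iota ltnS jn andbT.
have : f1 ^+ 2 %| f1 ^+ j by rewrite -(eqp_dvdr _ gj) dvdp_gcd f12g dvdp_exp2l.
by rewrite dvdp_Pexp2l ?irr1.1.
Qed.

End Gcds.

Theorem proposition5p12 (F : finFieldType) (f1 f2 : {poly F}) (n : nat)
    (irr1 : irreducible_poly f1) (irr2 : irreducible_poly f2)
    (f1Nf2 : ~~ (f1 %= f2)) (same_deg : size f1 = size f2) (n_ge2 : (2 <= n)%N) :
  let f := f1 ^+ n * f2 in
  graph_isomorphic (@gcd_adj F f (divs1 f1 f2 n)) (@gcd_adj F f (divs2 f1 f2)).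
Proof.
move=> f; have sf : (1 < size f)%N by apply: size_f_gt1.
have nz1 := irredp_neq0 irr1; have nz2 := irredp_neq0 irr2.
have cop : coprimep (f1 ^+ n) f2 by rewrite coprimep_expl ?irredp_coprimep.
have [phi [phiE phiK phi_compat]] :=
  exists_digit_swap _ _ _ _ n_ge2 cop nz1 nz2 same_deg.
pose cls := in_qpoly (monic_assoc f).
pose Phi (a : {poly %/ monic_assoc f}) := cls (phi a).
have clsK a : cls (a : {poly %/ monic_assoc f}) = a.
  exact/val_inj/in_qpoly_small/size_mk_monic.
have PhiK : involutive Phi.
  move=> a; rewrite -[RHS]clsK; apply/eqP; rewrite in_poly_quot_eq //.
  (* The representative of the class of [phi a] may differ from [phi a]; [phi_compat] absorbs the
     difference. *)
  rewrite -(subrK (phi (phi a)) (phi _)) -addrA dvdp_add ?phiK // phi_compat //.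
  by rewrite -in_poly_quot_eq // [X in X == _]clsK.
exists Phi; split; first by exists Phi.
move=> a b; rewrite -[in RHS](clsK a) -[in RHS](clsK b) !gcd_adj_class //.
rewrite mem_gcdp_divs1 // mem_gcdp_divs2 // !dvdp_sqr_subE // !dvdp_subE.
have [-> -> ->] := phiE a; have [-> -> ->] := phiE b.
(* If the residues mod [f1] agree, both sides ask for equal digits and distinct residues mod [f2];
   otherwise both hold. *)
by case: eqVneq.
Qed.
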